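(* Fix an integer $\Delta\ge 2$ and define $T_{\Delta}=\frac{(\Delta-1)^{\Delta+1}}{\Delta^{\Delta}}$. There exists an open set $\Omega_{\Delta}\subseteq\mathbb{C}$ containing the ray $(T_\Delta,\infty)$ such that for every finite simple graph $G$ with maximum degree $\Delta(G)\le\Delta$ one has $D(G,z)\ne 0$ for all $z\in\Omega_\Delta$.
   Context: A set $S\subseteq V(G)$ is dominating if every vertex of $G$ is in $S$ or adjacent to a vertex of $S$. For a graph $G$ on $n$ vertices, $d_k(G)$ is the number of dominating sets of size $k$, and the domination polynomial is $D(G,x)=\sum_{k=0}^n d_k(G)x^k$. *)

(* Defs.v *)
From HB Require Import structures.
From mathcomp Require Import all_boot all_order all_algebra.
From mathcomp Require Import complex.
From mathcomp Require Import boolp classical_sets reals topology normedtype.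

Set Implicit Arguments.
Unset Strict Implicit.
Unset Printing Implicit Defensive.

Import Order.TTheory GRing.Theory Num.Theory.
Import numFieldNormedType.Exports.

Local Open Scope ring_scope.

(* A finite simple graph is a finite vertex type with a symmetric irreflexive
   adjacency relation; the definitions below only take the relation. *)

Definition max_degree (V : finType) (adj : rel V) : nat :=
  \max_(v : V) #|[set u : V | adj v u]%SET|.

Definition dominating (V : finType) (adj : rel V) (S : {set V}) : bool :=
  [forall v : V, (v \in S) || [exists u in S, adj v u]].

Definition dominating_count (V : finType) (adj : rel V) (k : nat) : nat :=
  #|[set S : {set V} | dominating adj S & #|S| == k]%SET|.

Definition domination_poly (K : nzRingType) (V : finType) (adj : rel V) :
    {poly K} :=
  \sum_(k < #|V|.+1) (dominating_count adj k)%:R *: 'X^k.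

Definition threshold (R : realType) (Delta : nat) : R :=
  (Delta%:R - 1) ^+ Delta.+1 / Delta%:R ^+ Delta.

(* Main.v *)
Require Import Defs.
From HB Require Import structures.
From mathcomp Require Import all_boot all_order all_algebra.
From mathcomp Require Import complex zify ring lra.
From mathcomp Require Import boolp classical_sets reals topology normedtype.

Set Implicit Arguments.
Unset Strict Implicit.
Unset Printing Implicit Defensive.

Import Order.TTheory GRing.Theory Num.Theory.
Import numFieldNormedType.Exports.

Local Open Scope ring_scope.
Local Open Scope complex_scope.

(** The complement of a dominating set contains no closed neighbourhood, so
D(G, z) = z^n I(1/z), where I is the independence polynomial of the hypergraph
whose edges are the closed neighbourhoods; each vertex lies in at most Delta + 1
of them. Put lambda = 1/z. Deciding one vertex v gives
[Z(W, A) = Z(W - v, A - A_v) + lambda Z(W - v, A)], where A_v is the set of edges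
through v, and the quotient r of the two terms is [lambda * \prod_i (1 - p_i)]
with one factor for each edge through v; p_i is a product of ratios r' / (1 + r')
of vertices that have lost at least one edge, hence have at most d = Delta edges.

All the ratios p = r / (1 + r) stay in a Stolz domain c |1 - p| <= 1 - |p| with
c = 1 - eta close to 1. It is closed under products, so only
r = lambda * \prod_i (1 - p_i) has to be examined. Write 1 - p_i = q_i u_i with
|u_i| = 1 and gamma = 1 - eta / 2. Membership of p_i implies
|u_i - 1|^2 <= 2 eta s_i with s_i = 1 - gamma q_i, whereas membership of r / (1 + r)
follows from |r / |r| - 1|^2 <= 2 eta (1 + gamma / |r|). As
|\prod u_i - 1| <= \sum |u_i - 1|, Cauchy-Schwarz reduces the step for real lambda
to d \sum s_i - 1 <= gamma / |r|, and this is AM-GM, because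
T_d = (d - 1)^(d + 1) / d^d is the maximum of \prod (1 - s_i) (d \sum s_i - 1).
The strict inequality z > T_d leaves room for a small argument of lambda. *)

(** * Modulus and direction of complex numbers *)

Section ComplexModulus.
Variable R : rcfType.
Implicit Types w z : R[i].

(** The norm of [R[i]] takes values in [R[i]]; this one lies in the ordered field [R]. *)
Definition modulus z : R := Normc.normc z.

Arguments modulus : simpl never.

(** Division by zero gives the value [0] at [0], so multiplicativity has no exception. *)
Definition direction z : R[i] := z / (modulus z)%:C.

Lemma modulusE z : modulus z = Num.sqrt (complex.Re z ^+ 2 + complex.Im z ^+ 2).
Proof. by case: z. Qed.

Lemma modulus_sqr z : modulus z ^+ 2 = complex.Re z ^+ 2 + complex.Im z ^+ 2.
Proof. by rewrite modulusE sqr_sqrtr // addr_ge0 // sqr_ge0. Qed.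

Lemma modulus_ge0 z : 0 <= modulus z.
Proof. by rewrite modulusE sqrtr_ge0. Qed.

Lemma modulus_eq0 z : (modulus z == 0) = (z == 0).
Proof.
apply/eqP/eqP => [|->]; [exact: Normc.eq0_normc | exact: Normc.normc0].
Qed.

Lemma modulus_gt0 z : (0 < modulus z) = (z != 0).
Proof. by rewrite lt_neqAle modulus_ge0 eq_sym modulus_eq0 andbT. Qed.

Lemma modulusM w z : modulus (w * z) = modulus w * modulus z.
Proof. exact: Normc.normcM. Qed.

Lemma modulus0 : modulus 0 = 0. Proof. exact: Normc.normc0. Qed.

Lemma modulus1 : modulus 1 = 1. Proof. exact: Normc.normc1. Qed.

Lemma modulusV z : modulus z^-1 = (modulus z)^-1.
Proof. exact: Normc.normcV. Qed.

Lemma modulusD w z : modulus (w + z) <= modulus w + modulus z.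
Proof. exact: le_normcD. Qed.

Lemma modulusBC w z : modulus (w - z) = modulus (z - w).
Proof.
apply/eqP; rewrite -(eqrXn2 (n := 2)) ?modulus_ge0 //.
by rewrite !modulus_sqr; apply/eqP; case: w z => a b [c d] /=; ring.
Qed.

Lemma modulus_real (x : R) : modulus x%:C = `|x|.
Proof. by rewrite /modulus /= expr0n addr0 sqrtr_sqr. Qed.

Lemma modulus_prod (I : finType) (A : {set I}) (f : I -> R[i]) :
  modulus (\prod_(i in A) f i) = \prod_(i in A) modulus (f i).
Proof. by rewrite (big_morph modulus modulusM modulus1). Qed.

Lemma directionM w z : direction (w * z) = direction w * direction z.
Proof. by rewrite /direction modulusM rmorphM invfM mulrACA. Qed.

Lemma direction1 : direction 1 = 1.
Proof. by rewrite /direction modulus1 divr1. Qed.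

Lemma direction_prod (I : finType) (A : {set I}) (f : I -> R[i]) :
  direction (\prod_(i in A) f i) = \prod_(i in A) direction (f i).
Proof. by rewrite (big_morph direction directionM direction1). Qed.

Lemma modulus_direction z : z != 0 -> modulus (direction z) = 1.
Proof.
move=> z0; rewrite /direction modulusM modulusV modulus_real.
by rewrite ger0_norm ?modulus_ge0 // divff // modulus_eq0.
Qed.

Lemma modulus_direction_sub1 z : z != 0 ->
  modulus (direction z - 1) ^+ 2 = 2 - 2 * complex.Re z / modulus z.
Proof.
move=> z0; have nz0 : modulus z != 0 by rewrite modulus_eq0.
have nE := modulus_sqr z.
rewrite modulus_sqr /direction -fmorphV; move: nz0 nE; case: (z) => x y /=.
set n := modulus _ => nz0 nE.
have -> : (x * n^-1 - y * 0 - 1) ^+ 2 + (x * 0 + y * n^-1 - 0) ^+ 2 =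
  (x ^+ 2 + y ^+ 2) / n ^+ 2 + 1 - 2 * x / n by field.
by rewrite -nE divff ?expf_neq0 //; ring.
Qed.

Lemma modulus_prod_sub1 (I : finType) (A : {set I}) (u : I -> R[i]) :
    (forall i, i \in A -> modulus (u i) = 1) ->
  modulus (\prod_(i in A) u i - 1) <= \sum_(i in A) modulus (u i - 1).
Proof.
move=> u1; suff [] : modulus (\prod_(i in A) u i - 1) <=
    \sum_(i in A) modulus (u i - 1) /\ modulus (\prod_(i in A) u i) = 1 by [].
apply: (big_rec2 (fun x y => modulus (x - 1) <= y /\ modulus x = 1)).
  by rewrite subrr modulus0 modulus1.
move=> i x y iA [le_xy x1]; rewrite modulusM x1 u1 // mulr1; split=> //.
have -> : u i * x - 1 = u i * (x - 1) + (u i - 1) by ring.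
by rewrite (le_trans (modulusD _ _)) // modulusM u1 // mul1r addrC lerD2l.
Qed.

End ComplexModulus.

(** * Stolz domains and angular deviation *)

Section StolzDomain.
Variable R : rcfType.
Implicit Types (c eta : R) (p r : R[i]).

(* In terms of [r = p / (1 - p)] this is [c + |r| <= |1 + r|], the inside of one
   branch of a hyperbola with foci [0] and [-1]. *)
Definition stolz c p := c * modulus (1 - p) <= 1 - modulus p.

Lemma stolz0 c : c <= 1 -> stolz c 0.
Proof. by move=> c1; rewrite /stolz subr0 modulus0 modulus1 subr0 mulr1. Qed.

Lemma stolz1 c : stolz c 1.
Proof. by rewrite /stolz subrr modulus0 modulus1 subrr mulr0. Qed.

(** Since [1 - p r = (1 - p) + p (1 - r)], the left side is at most [(1 - |p|) + |p| (1 - |r|)]. *)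
Lemma stolzM c p r : 0 <= c -> stolz c p -> stolz c r -> stolz c (p * r).
Proof.
rewrite /stolz => c0 hp hr; rewrite modulusM.
have tri : modulus (1 - p * r) <= modulus (1 - p) + modulus p * modulus (1 - r).
  rewrite -modulusM (_ : 1 - p * r = 1 - p + p * (1 - r)) ?modulusD //; ring.
have := ler_wpM2l c0 tri; have := ler_wpM2l (modulus_ge0 p) hr.
rewrite mulrDr mulrCA; lra.
Qed.

Lemma stolz_occupancy c r : 0 < c -> c + modulus r <= modulus (1 + r) ->
  1 + r != 0 /\ stolz c (r / (1 + r)).
Proof.
move=> c0 hr; have r1 : 0 < modulus (1 + r) by have := modulus_ge0 r; lra.
have nz : 1 + r != 0 by rewrite -modulus_gt0.
split=> //; rewrite /stolz.
have -> : 1 - r / (1 + r) = (1 + r)^-1 by field.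
rewrite !modulusM modulusV -(ler_pM2r r1) mulrBl.
rewrite -!mulrA mulVf ?mulr1 ?mul1r ?gt_eqF //; lra.
Qed.

(** Law of cosines in the triangle [0], [1], [p], with [|p| <= 1 - (1 - eta) |1 - p|] squared. The
    factor [1 - eta / 2] comes from [1 - (1 - eta)^2 = 2 eta (1 - eta / 2)]. *)
Lemma stolz_direction eta p : 0 <= eta <= 1 -> stolz (1 - eta) p -> p != 1 ->
  modulus (direction (1 - p) - 1) ^+ 2 <=
    2 * eta * (1 - (1 - eta / 2) * modulus (1 - p)).
Proof.
move=> /andP[e0 e1]; rewrite /stolz => hp p1.
have w0 : 1 - p != 0 by rewrite subr_eq0 eq_sym.
rewrite modulus_direction_sub1 //.
have q0 : 0 < modulus (1 - p) by rewrite modulus_gt0.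
have ReE : 2 * complex.Re (1 - p) = 1 + modulus (1 - p) ^+ 2 - modulus p ^+ 2.
  by rewrite !modulus_sqr; case: (p) => x y /=; ring.
rewrite ReE -(ler_pM2r q0) mulrBl divfK ?gt_eqF //.
move: q0 hp (modulus_ge0 p); move: (modulus (1 - p)) (modulus p) => q m q0 hp m0.
have : m ^+ 2 <= (1 - (1 - eta) * q) ^+ 2 by apply: lerXn2r; rewrite ?nnegrE; lra.
nra.
Qed.

(** Multiplied by [|r|], the hypothesis becomes the square of the conclusion. *)
Lemma lens_direction eta r : 0 <= eta <= 1 -> r != 0 ->
    modulus (direction r - 1) ^+ 2 <=
      2 * eta * (1 + (1 - eta / 2) / modulus r) ->
  1 - eta + modulus r <= modulus (1 + r).
Proof.
move=> /andP[e0 e1] r0; rewrite modulus_direction_sub1 //.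
have n0 : 0 < modulus r by rewrite modulus_gt0.
rewrite -(ler_pM2r n0).
have -> : (2 - 2 * complex.Re r / modulus r) * modulus r =
  2 * modulus r - 2 * complex.Re r by field; rewrite gt_eqF.
have -> : 2 * eta * (1 + (1 - eta / 2) / modulus r) * modulus r =
  2 * eta * (modulus r + (1 - eta / 2)) by field; rewrite gt_eqF.
move=> h.
have : (1 - eta + modulus r) ^+ 2 <= modulus (1 + r) ^+ 2.
  move: h (modulus_sqr r); rewrite (modulus_sqr (1 + r)).
  case: (r) => x y /=; nra.
by rewrite ler_pXn2r ?nnegrE ?modulus_ge0 //; lra.
Qed.

End StolzDomain.

(** * Cauchy-Schwarz, AM-GM and Bernoulli inequalities *)

Section Inequalities.
Variable R : realType.

Lemma sqr_sum_le (I : finType) (A : {set I}) (t : I -> R) :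
  (\sum_(i in A) t i) ^+ 2 <= #|A|%:R * \sum_(i in A) t i ^+ 2.
Proof.
have [A0|A0] := eqVneq #|A| 0%N.
  move/eqP: A0; rewrite cards_eq0 => /eqP->.
  by rewrite !big_set0 expr0n cards0 mul0r.
have m0 : 0 < #|A|%:R :> R by rewrite ltr0n lt0n.
set S := \sum_(i in A) t i; set a := S / #|A|%:R.
(* Squares of the deviations from the mean [a] are nonnegative. *)
have : \sum_(i in A) (2 * a * t i - a ^+ 2) <= \sum_(i in A) t i ^+ 2.
  by apply: ler_sum => i _; have := sqr_ge0 (t i - a); nra.
rewrite sumrB -mulr_sumr sumr_const -/S -mulr_natl -(ler_pM2l m0).
by rewrite (_ : _ * (_ - _) = S ^+ 2) // /a; field; rewrite gt_eqF.
Qed.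

(* AM-GM for the [d + 1] numbers [1 - s i], padded by ones up to [d] of them, and
   [(d * \sum s - 1) / d], whose sum is [d - 1 / d] whatever the [s i] are. *)
Lemma amgm_threshold (I : finType) (A : {set I}) (s : I -> R) (d : nat) :
    (0 < d)%N -> (#|A| <= d)%N -> (forall i, i \in A -> 0 <= s i <= 1) ->
  (\prod_(i in A) (1 - s i)) * (d%:R * \sum_(i in A) s i - 1) <= threshold R d.
Proof.
move=> d0 Ad s01.
have dp : 0 < d%:R :> R by rewrite ltr0n.
have d1 : 1 <= d%:R :> R by rewrite ler1n.
have P0 : 0 <= \prod_(i in A) (1 - s i).
  by apply: prodr_ge0 => i /s01 /andP[_]; rewrite subr_ge0.
have T0 : 0 <= threshold R d.
  by rewrite /threshold divr_ge0 // exprn_ge0 // subr_ge0.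
set S := \sum_(i in A) s i.
have [neg|pos] := lerP (d%:R * S - 1) 0.
  by apply: le_trans T0; rewrite mulr_ge0_le0.
have [m mE] : exists m, (#|A| + m)%N = d by exists (d - #|A|)%N; rewrite subnKC.
pose J := (I + 'I_m + unit)%type.
pose B : {pred J} := [pred j : J | if j is inl (inl i) then i \in A else true].
pose E (j : J) : R :=
  match j with inl (inl i) => 1 - s i | inl (inr _) => 1
             | inr _ => (d%:R * S - 1) / d%:R end.
have BE (T : Type) (idx : T) (op : Monoid.com_law idx) (F : J -> T) :
    \big[op/idx]_(j in B) F j = op (op (\big[op/idx]_(i in A) F (inl (inl i)))
      (\big[op/idx]_(k < m) F (inl (inr k)))) (F (inr tt)).
  rewrite big_sumType big_sumType /=; congr (op _ _).
  by rewrite (big_pred1 tt) //; case.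
have cardB : #|B| = d.+1.
  by rewrite -sum1_card BE /= sum1_card sum1_card card_ord addn1 mE.
have E0 : {in B, forall j, 0 <= E j}.
  move=> [[i iA|k _]|[] _] //=; last by rewrite divr_ge0 // ltW.
  by rewrite subr_ge0; case/andP: (s01 i iA).
have := (leif_AGM E0).1; rewrite cardB !BE /= !big1_eq.
rewrite sumr_const card_ord sumrB sumr_const mulr1 -/S.
(* The mean is [(d - 1) / d], and [d ((d - 1) / d)^(d + 1)] is the threshold. *)
have -> : (1 *+ #|A| - S + 1 *+ m + (d%:R * S - 1) / d%:R) / d.+1%:R =
    (d%:R - 1) / d%:R :> R.
  rewrite [1 *+ _ - S + _]addrAC -mulrnDr mE -natr1; field.
  by rewrite !gt_eqF //; lra.
rewrite mulrA -(ler_pM2l dp) mulrC divfK ?gt_eqF // => /le_trans; apply.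
rewrite /threshold expr_div_n [d%:R ^+ d.+1]exprS le_eqVlt; apply/orP; left.
by apply/eqP; field; rewrite expf_neq0 gt_eqF.
Qed.
Lemma bernoulli_le (a : R) n : 0 <= a <= 1 -> 1 - n%:R * a <= (1 - a) ^+ n.
Proof.
move=> /andP[a0 a1]; elim: n => [|n IH]; first by rewrite mul0r subr0 expr0.
rewrite exprS -natr1; have n0 : 0 <= n%:R :> R by [].
have : (1 - a) * (1 - n%:R * a) <= (1 - a) * (1 - a) ^+ n.
  by rewrite ler_wpM2l // subr_ge0.
nra.
Qed.

End Inequalities.

Lemma eta_le_eighth (R : realFieldType) (d : nat) (eta : R) :
  0 < eta -> 2 * eta * d.+2%:R ^+ 2 <= 1 -> eta <= 1 / 8.
Proof.
have : 4 <= d.+2%:R ^+ 2 :> R by rewrite -natrX ler_nat; lia.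
by move: (d.+2%:R ^+ 2 : R) => D; nra.
Qed.

(** * One step of the ratio recursion *)

Section Recursion.
Variables (R : realType) (d : nat) (eta delta kappa : R) (lam : R[i]).
Hypotheses (d0 : (0 < d)%N) (lam0 : lam != 0) (eta0 : 0 < eta).
Hypothesis eta_small : 2 * eta * d.+2%:R ^+ 2 <= 1.
Hypotheses (kappa_small : kappa <= 1 / d.+2%:R)
  (kappa_eta : kappa * (kappa + 2 * d%:R) <= 2 * eta * delta)
  (delta0 : 0 <= delta).
Hypothesis lam_direction : modulus (direction lam - 1) <= kappa.
Hypothesis lam_modulus :
  threshold R d + delta <= (1 - eta / 2) ^+ d.+1 / modulus lam.

Variables (I : finType) (A : {set I}) (p : I -> R[i]).
Hypothesis p_stolz : forall i, i \in A -> stolz (1 - eta) (p i).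

Let r := lam * \prod_(i in A) (1 - p i).
Let t i := modulus (direction (1 - p i) - 1).
Let s i := 1 - (1 - eta / 2) * modulus (1 - p i).

Let d2 : 2 <= d.+2%:R :> R. Proof. by rewrite ler_nat. Qed.

Let eta_le : eta <= 1 / 8 := eta_le_eighth eta0 eta_small.

Let kappa0 : 0 <= kappa.
Proof. exact: le_trans (modulus_ge0 _) lam_direction. Qed.

Let p_neq1 : r != 0 -> forall i, i \in A -> p i != 1.
Proof.
rewrite mulf_eq0 negb_or => /andP[_ /prodf_neq0 h] i /h.
by rewrite subr_eq0 eq_sym.
Qed.

Let t2_le : r != 0 -> forall i, i \in A -> t i ^+ 2 <= 2 * eta * s i.
Proof.
move=> r0 i iA; apply: stolz_direction; [|exact: p_stolz|exact: p_neq1].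
by move: eta_le eta0; lra.
Qed.

Let s_le1 i : s i <= 1.
Proof.
have := modulus_ge0 (1 - p i); rewrite /s => ?.
rewrite lerBlDr lerDl mulr_ge0 //; move: eta_le; lra.
Qed.

Let s_ge0 : r != 0 -> forall i, i \in A -> 0 <= s i.
Proof.
move=> r0 i iA; have := t2_le r0 iA; have := sqr_ge0 (t i).
by move=> /le_trans h /h; rewrite pmulr_rge0 //; move: eta0; lra.
Qed.

(** [eta_small] is calibrated for this bound: with [kappa_small], the deviations of [d + 1] factors
    and of [lam] add up to at most [1]. *)
Let t_le : r != 0 -> forall i, i \in A -> t i <= 1 / d.+2%:R.
Proof.
move=> r0 i iA; have D0 : 0 < d.+2%:R :> R by rewrite ltr0n.
have t0 : 0 <= t i := modulus_ge0 _.
suff : t i ^+ 2 <= (1 / d.+2%:R) ^+ 2.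
  by rewrite ler_pXn2r ?nnegrE ?divr_ge0 // ltW.
apply: le_trans (t2_le r0 iA) _; rewrite expr_div_n expr1n ler_pdivlMr ?exprn_gt0 //.
apply: le_trans eta_small; apply: ler_wpM2r; first by rewrite exprn_ge0 ?ltW.
by rewrite ler_piMr // mulr_ge0 // ltW.
Qed.

Let direction_le : r != 0 ->
  modulus (direction r - 1) <= kappa + \sum_(i in A) t i.
Proof.
move=> r0; rewrite /r directionM direction_prod.
set u := \prod_(i in A) _; set l := direction lam.
have -> : l * u - 1 = (l - 1) + l * (u - 1) by ring.
rewrite (le_trans (modulusD _ _)) // lerD // modulusM modulus_direction // mul1r.
apply: modulus_prod_sub1 => i iA; apply: modulus_direction.
by rewrite subr_eq0 eq_sym p_neq1.
Qed.

Lemma lens_recursion : (#|A| <= d)%N -> 1 - eta + modulus r <= modulus (1 + r).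
Proof.
move=> Ad; have [->|r0] := eqVneq r 0.
  by rewrite modulus0 addr0 addr0 modulus1; move: eta0; lra.
apply: lens_direction => //; first by move: eta_le eta0; lra.
set S := \sum_(i in A) s i; set P := \prod_(i in A) (1 - s i).
have AD : #|A|%:R <= d%:R :> R by rewrite ler_nat.
have rho0 : 0 < modulus r by rewrite modulus_gt0.
have g0 : 0 < 1 - eta / 2 by move: eta_le; lra.
have l0 : 0 < modulus lam by rewrite modulus_gt0.
have PE : P = (1 - eta / 2) ^+ #|A| * \prod_(i in A) modulus (1 - p i).
  rewrite -prodr_const -big_split /=; apply: eq_bigr => i _.
  by rewrite /s; ring.
have rhoE : modulus r = modulus lam * \prod_(i in A) modulus (1 - p i).
  by rewrite /r modulusM modulus_prod.
have Q0 : 0 < \prod_(i in A) modulus (1 - p i).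
  by move: rho0; rewrite rhoE pmulr_rgt0.
have P0 : 0 < P by rewrite PE mulr_gt0 // exprn_gt0.
have P1 : P <= 1.
  apply: prodr_ile1 => i iA; rewrite subr_ge0 s_le1 lerBlDr lerDl.
  exact: s_ge0.
have TP : P * (d%:R * S - 1) <= threshold R d.
  by apply: amgm_threshold => // i iA; rewrite s_ge0 ?s_le1.
(* Dividing the AM-GM bound by [P <= 1] does not shrink [delta]; lowering the exponent [d + 1] to
   [#|A| + 1] only increases the power of [1 - eta / 2]. *)
have bound : d%:R * S - 1 + delta <= (1 - eta / 2) / modulus r.
  apply: le_trans (_ : (threshold R d + delta) / P <= _).
    rewrite ler_pdivlMr //; move: TP delta0 P0 P1; nra.
  rewrite ler_pdivrMr // (le_trans lam_modulus) // rhoE PE.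
  set Q := \prod_(i in A) modulus (1 - p i).
  have -> : (1 - eta / 2) / (modulus lam * Q) * ((1 - eta / 2) ^+ #|A| * Q) =
      (1 - eta / 2) ^+ #|A|.+1 / modulus lam.
    by rewrite exprS; field; rewrite !gt_eqF.
  rewrite ler_pM2r ?invr_gt0 // ler_wiXn2l ?ltW //.
  by move: eta0; lra.
have St : (\sum_(i in A) t i) ^+ 2 <= 2 * eta * (d%:R * S).
  apply: le_trans (sqr_sum_le _ _) _.
  apply: le_trans (_ : d%:R * (2 * eta * S) <= _); last by rewrite mulrCA.
  apply: ler_pM => //; first by apply: sumr_ge0 => i _; exact: sqr_ge0.
  by rewrite mulr_sumr; apply: ler_sum => i; exact: t2_le.
have Sd : 0 <= \sum_(i in A) t i <= d%:R.
  rewrite sumr_ge0 => [/=|i _]; last exact: modulus_ge0.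
  apply: le_trans AD; rewrite -sum1_card natr_sum; apply: ler_sum => i iA.
  apply: le_trans (t_le r0 iA) _.
  by rewrite ler_pdivrMr ?ltr0n // mul1r; move: d2; lra.
apply: le_trans (_ : (kappa + \sum_(i in A) t i) ^+ 2 <= _).
  rewrite ler_pXn2r ?nnegrE ?modulus_ge0 ?direction_le // addr_ge0 //.
  by case/andP: Sd.
(* With [X] the sum of the [t i], [(kappa + X)^2 <= kappa (kappa + 2 d) + 2 eta d S]; [kappa_eta]
   absorbs the first term into the slack [delta]. *)
move: Sd St bound kappa_eta kappa0 eta0.
move: (\sum_(i in A) t i) ((1 - eta / 2) / modulus r) (d%:R * S) => X Y Z.
move: (d%:R : R) => D /andP[X0 XD]; nra.
Qed.

(** A vertex that still has all its edges only needs [r != -1]: the direction of [-1] is at distance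
    [2] from [1], while that of [r] is within distance [1]. *)
Lemma root_recursion : (#|A| <= d.+1)%N -> 1 + r != 0.
Proof.
move=> Ad; have [->|r0] := eqVneq r 0; first by rewrite addr0 oner_eq0.
apply/negP => /eqP /(canRL (addKr _)); rewrite addr0 => rE.
have := direction_le r0.
have -> : direction r - 1 = (- 2)%:C.
  rewrite rE /direction (_ : modulus (-1) = 1) ?divr1.
    by rewrite rmorphN /= rmorph_nat; ring.
  by rewrite -[-1](rmorphN1 (real_complex R)) modulus_real normrN1.
rewrite modulus_real normrN ger0_norm //.
have : \sum_(i in A) t i <= d.+1%:R * (1 / d.+2%:R).
  apply: le_trans (_ : #|A|%:R * (1 / d.+2%:R) <= _); last first.
    by rewrite ler_wpM2r ?divr_ge0 // ler_nat.
  rewrite mulr_natl -sumr_const; apply: ler_sum; exact: t_le.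
have : (1 / d.+2%:R : R) * d.+2%:R = 1 by rewrite divfK ?pnatr_eq0.
rewrite -(natr1 d.+1).
move: kappa_small; rewrite -(natr1 d.+1).
move: (1 / _) => X; move: (d.+1%:R : R) => D; lra.
Qed.

End Recursion.

(** * Independence sums of a hypergraph *)

Section Hypergraph.
Import boot.fintype boot.finset.
Variables (F : fieldType) (V E : finType) (e : E -> {set V}) (lam : F).
Implicit Types (W X S : {set V}) (A B C : {set E}).

(* The independence polynomial, at [lam], of the hypergraph left when the vertices
   outside [W] are occupied and only the edges of [A] are constraints; an occupied
   vertex shrinks its edges, an unoccupied one removes them from [A]. *)
Definition indep_sum W A : F :=
  \sum_(S : {set V} | (S \subset W) && [forall i in A, ~~ (e i :&: W \subset S)])
    lam ^+ #|S|.

Definition edge_degree A (u : V) := #|[set i in A | u \in e i]|.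

(** An edge missing [W] is already fully occupied, so its constraint cannot be met. *)
Definition nondegenerate W A := forall i, i \in A -> e i :&: W != set0.

Lemma indep_sum_contract W A X : X \subset W ->
  \sum_(S : {set V} | [&& S \subset W, X \subset S &
      [forall i in A, ~~ (e i :&: W \subset S)]]) lam ^+ #|S|
    = lam ^+ #|X| * indep_sum (W :\: X) A.
Proof.
move=> XW; rewrite /indep_sum big_distrr /=.
rewrite (reindex_onto (fun S => X :|: S) (fun S => S :\: X)) /=; last first.
  by move=> S /and3P[_ XS _]; rewrite -{1}(setIidPr XS) setID.
have DX S : ((X :|: S) :\: X == S) = [disjoint S & X].
  by rewrite setDUl setDv set0U; apply/eqP/setDidPl.
apply: eq_big => [S|S].
  rewrite DX subsetUl subUset XW subsetD /=.
  have [dSX|] := boolP [disjoint S & X]; rewrite ?andbF // !andbT; congr (_ && _).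
  apply: eq_forallb => i; congr (_ ==> ~~ _).
  by rewrite setDE setIA -setDE subDset.
rewrite DX => /andP[_ dSX].
by rewrite cardsU setIC disjoint_setI0 // cards0 subn0 exprD.
Qed.

(** If [v] is unoccupied, all edges through it are satisfied; if occupied, contract [v]. *)
Lemma indep_sum_vertex W A v : v \in W ->
  indep_sum W A = indep_sum (W :\ v) (A :\: [set i | v \in e i])
                  + lam * indep_sum (W :\ v) A.
Proof.
move=> vW; rewrite addrC [LHS](bigID (fun S => v \in S)) /=; congr (_ + _).
  rewrite -[X in X * _]expr1 -(cards1 v) -indep_sum_contract ?sub1set //.
  by apply: eq_bigl => S; rewrite sub1set andbAC -andbA.
apply: eq_bigl => S; rewrite subsetD1 andbAC; case vS: (v \in S); rewrite ?andbF //=.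
rewrite !andbT; congr (_ && _); apply: eq_forallb => i; rewrite !inE.
case iA: (i \in A); rewrite ?andbF //= andbT.
case ve: (v \in e i) => /=.
  by apply/negP => /subsetP /(_ v); rewrite inE ve vW vS => /(_ isT).
suff -> : e i :&: (W :\ v) = e i :&: W by [].
by apply/setP => x; rewrite !inE; case: eqP => // ->; rewrite ve.
Qed.

(** The new constraint discards the sets in which the edge is fully occupied; contraction sums
    them. *)
Lemma indep_sum_edge W A i : indep_sum W (i |: A) =
  indep_sum W A - lam ^+ #|e i :&: W| * indep_sum (W :\: e i) A.
Proof.
have -> : W :\: e i = W :\: (e i :&: W) by rewrite setDIr setDv setU0.
rewrite -indep_sum_contract ?subsetIr //.
rewrite [indep_sum W A](bigID (fun S => e i :&: W \subset S)) /=.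
set a := \sum_(S | _ && _) _; set b := \sum_(S | [&& _, _ & _]) _.
have -> : a = b by apply: eq_bigl => S; rewrite andbAC -andbA.
rewrite addrC addrK; apply: eq_bigl => S; rewrite -andbA; congr (_ && _).
apply/forall_inP/andP => [h|[/forall_inP h hi] j].
  split; last by apply: h; rewrite setU11.
  by apply/forall_inP => j jA; apply: h; rewrite setU1r.
by case/setU1P => [->|/h].
Qed.

Lemma indep_sum_degenerate W A : ~ nondegenerate W A -> indep_sum W A = 0.
Proof.
move=> nd; apply: big_pred0 => S; apply/negP => /andP[_ /forall_inP h].
by apply: nd => i /h; apply: contra => /eqP->; rewrite sub0set.
Qed.

Lemma nondegenerateP W A : nondegenerate W A \/ ~ nondegenerate W A.
Proof.
have [/forall_inP|] := boolP [forall i in A, e i :&: W != set0]; first by left.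
by move/forall_inP; right.
Qed.

(** * Zero-freeness from a domain stable under the recursion *)

Variables (dom : F -> Prop) (d : nat).
Hypotheses (dom0 : dom 0) (dom1 : dom 1).
Hypothesis domM : forall p q, dom p -> dom q -> dom (p * q).
Hypothesis dom_step : forall A (p : E -> F), (#|A| <= d)%N ->
  (forall i, i \in A -> dom (p i)) ->
  let r := lam * \prod_(i in A) (1 - p i) in 1 + r != 0 /\ dom (r / (1 + r)).
Hypothesis dom_root : forall A (p : E -> F), (#|A| <= d.+1)%N ->
  (forall i, i \in A -> dom (p i)) -> 1 + lam * \prod_(i in A) (1 - p i) != 0.
Hypothesis edge_degree_le : forall u, (edge_degree setT u <= d.+1)%N.

(* For positive [lam] the quotient is the probability that all of [X] is occupied. *)
Definition zero_free W := forall B, nondegenerate W B ->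
  indep_sum W B != 0 /\
  forall X, X \subset W -> (forall u, u \in X -> (edge_degree B u <= d)%N) ->
    dom (lam ^+ #|X| * indep_sum (W :\: X) B / indep_sum W B).

Lemma edge_degreeS A B u : A \subset B -> (edge_degree A u <= edge_degree B u)%N.
Proof.
move=> /subsetP AB; apply: subset_leq_card; apply/subsetP => i.
by rewrite !inE => /andP[/AB-> ->].
Qed.

(** The edges of [C] are added one at a time; [p i] is the ratio for full occupation of [e i] before
    [i] is added. At that moment the vertices of [e i] lack the edge [i], hence have degree at most
    [d]. *)
Lemma zero_free_edges W B C : zero_free W -> nondegenerate W B ->
  [disjoint B & C] -> exists2 p : E -> F, forall i, i \in C -> dom (p i) &
    indep_sum W (B :|: C) = indep_sum W B * \prod_(i in C) (1 - p i).
Proof.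
move=> zf ndB; have [n] := ubnP #|C|; elim: n C => // n IH C.
have [->|[i iC]] := set_0Vmem C => Cn dBC.
  by exists (fun=> 0) => [i|]; rewrite ?inE // setU0 big_set0 mulr1.
have [||p pdom pE] := IH (C :\ i).
- by move: Cn; rewrite (cardsD1 i) iC.
- exact: disjointWr (subsetDl _ _) dBC.
set B1 := B :|: C :\ i.
have BCE : B :|: C = i |: B1 by rewrite /B1 setUCA setD1K.
have iB1 : i \notin B1.
  rewrite !inE eqxx orbF; apply/negP => iB.
  by move/disjoint_setI0/setP: dBC => /(_ i); rewrite !inE iB iC.
pose q := lam ^+ #|e i :&: W| * indep_sum (W :\: e i) B1 / indep_sum W B1.
have prodE x : \prod_(j in C) (1 - (if j == i then x else p j)) =
    (1 - x) * \prod_(j in C :\ i) (1 - p j).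
  rewrite (big_setD1 i) //= eqxx; congr (_ * _); apply: eq_bigr => j.
  by rewrite !inE => /andP[/negPf->].
have domE x : dom x -> forall j, j \in C -> dom (if j == i then x else p j).
  by move=> dx j jC; case: eqP => // /eqP ji; apply: pdom; rewrite !inE ji.
(* In the degenerate case both sides vanish, and [0] serves as the missing ratio. *)
have [nd|nd] := nondegenerateP W B1; last first.
  exists (fun j => if j == i then 0 else p j); first exact: domE.
  rewrite prodE subr0 mul1r -pE -/B1 BCE !indep_sum_degenerate // => ndC.
  by apply: nd => j jB; apply: ndC; rewrite inE jB orbT.
have [Z0 zX] := zf _ nd.
exists (fun j => if j == i then q else p j).
  apply: domE; rewrite /q (_ : W :\: e i = W :\: (e i :&: W)); last first.
    by rewrite setDIr setDv setU0.
  apply: zX; first exact: subsetIr.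
  move=> u /setIP[ue _]; rewrite -ltnS; apply: leq_trans (edge_degree_le u).
  rewrite /edge_degree (cardsD1 i [set j in setT | _]) !inE ue ltnS.
  apply: subset_leq_card; apply/subsetP => j; rewrite !inE => /andP[jB ->].
  by rewrite !andbT; apply: contraNneq iB1 => <-; rewrite !inE.
by rewrite prodE BCE indep_sum_edge mulrCA -pE -/B1 /q; field.
Qed.

(** Induction on [#|W|]: removing one vertex gives nonvanishing and the ratio of a single vertex.
    For a set [X] the vertices are occupied successively, and the ratios multiply within [dom]. *)
Lemma zero_free_all W : zero_free W.
Proof.
have [n] := ubnP #|W|; elim: n W => // n IH W; rewrite ltnS => Wn B ndB.
have vertex v : v \in W -> indep_sum W B != 0 /\ ((edge_degree B v <= d)%N ->
    dom (lam * indep_sum (W :\ v) B / indep_sum W B)).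
  move=> vW; set W' := W :\ v; pose Bv := [set i in B | v \in e i].
  have zf : zero_free W' by apply: IH; move: Wn; rewrite (cardsD1 v) vW.
  have B'E : B :\: [set i | v \in e i] = B :\: Bv.
    by apply/setP => i; rewrite !inE; case: (i \in B); rewrite ?andbF.
  have nd' : nondegenerate W' (B :\: Bv).
    move=> i; rewrite !inE => /andP[+ iB]; rewrite iB => /= ve.
    have /set0Pn[x /setIP[xe xW]] := ndB i iB; apply/set0Pn; exists x.
    by rewrite !inE xe xW andbT; apply: contraNneq ve => <-.
  have dis : [disjoint B :\: Bv & Bv] by rewrite disjoints_subset subsetDr.
  have [Z0 _] := zf _ nd'.
  have [p pdom] := zero_free_edges zf nd' dis.
  have -> : B :\: Bv :|: Bv = B.
    by apply/setP => i; rewrite !inE; case: (i \in B); case: (v \in e i).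
  move=> pE; have ZE : indep_sum W B = indep_sum W' (B :\: Bv) *
      (1 + lam * \prod_(i in Bv) (1 - p i)).
    by rewrite (indep_sum_vertex _ vW) B'E -/W' pE; ring.
  have degBv : #|Bv| = edge_degree B v by [].
  split.
    rewrite ZE mulf_neq0 // dom_root // degBv.
    exact: leq_trans (edge_degreeS v (subsetT B)) (edge_degree_le v).
  (* The ratio of [v] is [r / (1 + r)], where [r] is the quotient of the two terms of
     [indep_sum_vertex]. *)
  move=> degd; have [|r1] := @dom_step Bv p _ pdom; first by rewrite degBv.
  rewrite ZE pE; congr dom; field.
  by rewrite r1.
have [W0|[v vW]] := set_0Vmem W.
  have B0 : B = set0.
    by apply/setP => i; rewrite inE; apply/negP => /ndB; rewrite W0 setI0 eqxx.
  have Z1 : indep_sum W B = 1.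
    rewrite /indep_sum (big_pred1 set0) ?cards0 ?expr0 // => S.
    rewrite W0 subset0 B0 (_ : [forall i in set0, _] = true) ?andbT //.
    by apply/forallP => i; rewrite inE.
  split=> [|X]; first by rewrite Z1 oner_eq0.
  by rewrite W0 subset0 => /eqP-> _; rewrite cards0 setD0 -W0 Z1 mul1r divr1.
have [Z0 _] := vertex v vW; split=> // X XW Xdeg.
have [->|[u uX]] := set_0Vmem X.
  by rewrite cards0 setD0 mul1r divff.
have uW := subsetP XW u uX; have [_ /(_ (Xdeg u uX)) domu] := vertex u uW.
have WXE : W :\: X = (W :\ u) :\: (X :\ u).
  by apply/setP => x; rewrite !inE; case: eqP => // ->; rewrite uX.
(* If occupying [u] alone fills an edge, the ratio for [X] is [0]. *)
have [nd|nd] := nondegenerateP (W :\ u) B; last first.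
  rewrite indep_sum_degenerate ?mulr0 ?mul0r // => ndX; apply: nd => i /ndX.
  case/set0Pn => x; rewrite !inE => /and3P[xe xX xW]; apply/set0Pn; exists x.
  by rewrite !inE xe xW andbT; apply: contraNneq xX => ->.
have zf : zero_free (W :\ u) by apply: IH; move: Wn; rewrite (cardsD1 u) uW.
have [Zu0 domX] := zf _ nd.
have := domM domu (domX (X :\ u) (setSD _ XW) _); rewrite -WXE.
rewrite (cardsD1 u X) uX exprS => h.
have -> : lam * lam ^+ #|X :\ u| * indep_sum (W :\: X) B / indep_sum W B =
  lam * indep_sum (W :\ u) B / indep_sum W B *
  (lam ^+ #|X :\ u| * indep_sum (W :\: X) B / indep_sum (W :\ u) B).
  by field; rewrite Zu0.
by apply: h => x; rewrite !inE => /andP[_]; exact: Xdeg.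
Qed.

End Hypergraph.

(** * Dominating sets as complements of independent sets *)

Section Domination.
Import boot.fintype boot.finset.
Variables (F : fieldType) (V : finType) (adj : rel V).

Definition closed_nbhd v := [set u | (u == v) || adj v u].

Lemma horner_domination_poly (z : F) :
  (domination_poly F adj).[z] = \sum_(S | dominating adj S) z ^+ #|S|.
Proof.
rewrite /domination_poly horner_sum.
rewrite (partition_big (fun S : {set V} => inord #|S| : 'I_#|V|.+1) xpredT) //=.
apply: eq_bigr => k _; rewrite hornerZ hornerXn mulr_natl /dominating_count.
rewrite -sumr_const; apply: eq_big => [S|S].
  rewrite !inE; congr (_ && _).
  by rewrite -val_eqE /= inordK // ltnS max_card.
by rewrite inE => /andP[_ /eqP->].
Qed.

Lemma domination_indep_sum (z : F) : z != 0 ->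
  (domination_poly F adj).[z] =
    z ^+ #|V| * indep_sum closed_nbhd z^-1 setT setT.
Proof.
move=> z0; rewrite horner_domination_poly /indep_sum big_distrr /=.
rewrite (reindex_inj (inv_inj (@setCK V))) /=; apply: eq_big => [S|S _].
  rewrite subsetT /dominating; apply: eq_forallb => v.
  rewrite !inE /= setIT.
  apply/orP/subsetPn => [[vS|/existsP[u /andP[uS avu]]]|[u]].
  - by exists v => //; rewrite inE eqxx.
  - by exists u; [rewrite inE avu orbT | rewrite -in_setC].
  rewrite inE => /orP[/eqP-> vS|avu uS]; first by left.
  by right; apply/existsP; exists u; rewrite inE uS avu.
have -> : #|V| = (#|S| + #|~: S|)%N by rewrite cardsC.
by rewrite exprD exprVn mulrAC divff ?mul1r // expf_neq0.
Qed.

(** By symmetry the edges through [u] are indexed by vertices of its closed neighbourhood. *)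
Lemma edge_degree_closed_nbhd (A : {set V}) u : symmetric adj ->
  (edge_degree closed_nbhd A u <= (max_degree adj).+1)%N.
Proof.
move=> sym; apply: leq_trans (_ : #|closed_nbhd u| <= _)%N.
  apply: subset_leq_card; apply/subsetP => v.
  by rewrite !inE eq_sym sym => /andP[].
rewrite /closed_nbhd (cardsD1 u) !inE eqxx add1n ltnS.
apply: leq_trans (leq_bigmax u); apply: subset_leq_card; apply/subsetP => v.
by rewrite !inE; case: eqP.
Qed.

End Domination.

(** * Choice of constants around a point of the ray *)

Section ZeroFreeNeighbourhood.
Import boot.fintype boot.finset.
Variables (R : realType) (d : nat).

Lemma domination_neq0 (eta delta kappa : R) (z : R[i]) (V : finType)
    (adj : rel V) :
    (0 < d)%N -> z != 0 -> 0 < eta -> 2 * eta * d.+2%:R ^+ 2 <= 1 ->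
    kappa <= 1 / d.+2%:R -> kappa * (kappa + 2 * d%:R) <= 2 * eta * delta ->
    0 <= delta -> modulus (direction z^-1 - 1) <= kappa ->
    threshold R d + delta <= (1 - eta / 2) ^+ d.+1 / modulus z^-1 ->
    symmetric adj -> (max_degree adj <= d)%N ->
  (domination_poly R[i] adj).[z] != 0.
Proof.
move=> d0 z0 e0 eD kD ke de0 zdir zmod sym deg.
rewrite domination_indep_sum // mulf_neq0 ?expf_neq0 //.
have zi0 : z^-1 != 0 by rewrite invr_eq0.
have e1 := eta_le_eighth e0 eD.
have c0 : 0 < 1 - eta by lra.
have zf : zero_free (closed_nbhd adj) z^-1 (stolz (1 - eta)) d setT.
  apply: zero_free_all.
  - by apply: stolz0; lra.
  - exact: stolz1.
  - by move=> p q; apply: stolzM; exact: ltW.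
  - move=> A p Ad pdom r; apply: stolz_occupancy => //.
    exact: (lens_recursion d0 zi0 e0 eD ke de0 zdir zmod pdom Ad).
  - move=> A p Ad pdom.
    exact: (root_recursion zi0 e0 eD kD zdir pdom Ad).
  - by move=> u; apply: leq_trans (edge_degree_closed_nbhd _ _ sym) _.
have [v _|//] := zf setT.
by apply/set0Pn; exists v; rewrite !inE eqxx.
Qed.

Lemma zero_free_nbhd (x : R) : (0 < d)%N -> threshold R d < x ->
  exists2 eps : R, 0 < eps & forall z : R[i], modulus (z - x%:C) < eps ->
    forall (V : finType) (adj : rel V), symmetric adj ->
      (max_degree adj <= d)%N -> (domination_poly R[i] adj).[z] != 0.
Proof.
move=> d0 Tx.
have T0 : 0 <= threshold R d.
  by rewrite /threshold divr_ge0 // exprn_ge0 // subr_ge0 ler1n.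
have x0 : 0 < x by lra.
set D : R := d.+2%:R; have D3 : 3 <= D by rewrite /D ler_nat.
(* Of the gap [4 delta], one [delta] pays for [|z|] below [x], two for the power of [1 - eta / 2],
   and one remains as slack. *)
pose delta := (x - threshold R d) / 4.
have de0 : 0 < delta by rewrite /delta; lra.
pose eta := Num.min (1 / (2 * D ^+ 2)) (4 * delta / (D * x)).
have e0 : 0 < eta.
  by rewrite lt_min !divr_gt0 ?mulr_gt0 ?exprn_gt0 //; lra.
have eD : 2 * eta * D ^+ 2 <= 1.
  have : eta <= 1 / (2 * D ^+ 2) by rewrite ge_min lexx.
  rewrite ler_pdivlMr ?mulr_gt0 ?exprn_gt0 //; lra.
have eDx : eta * D * x <= 4 * delta.
  have : eta <= 4 * delta / (D * x) by rewrite ge_min lexx orbT.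
  rewrite ler_pdivlMr ?mulr_gt0 ?mulrA //; lra.
(* Since [kappa <= 1] and [d <= D], the second bound gives [kappa (kappa + 2 d) <= 2 eta delta]. *)
pose kappa := Num.min (1 / D) (2 * eta * delta / (1 + 2 * D)).
have k0 : 0 < kappa.
  by rewrite lt_min !divr_gt0 ?mulr_gt0 //; lra.
have kD : kappa <= 1 / D by rewrite ge_min lexx.
have k1 : kappa <= 1.
  by apply: le_trans kD _; rewrite ler_pdivrMr; lra.
have kE : kappa * (1 + 2 * D) <= 2 * eta * delta.
  rewrite -ler_pdivlMr; last by lra.
  by rewrite ge_min lexx orbT.
have ke : kappa * (kappa + 2 * d%:R) <= 2 * eta * delta.
  apply: le_trans kE; rewrite ler_pM2l //.
  have : d%:R <= D by rewrite /D ler_nat; lia.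
  lra.
(* The bound [x / 2] keeps [|z| > x / 2], so the directional error, at most [2 |z - x| / |z|], stays
   below [kappa]. *)
pose eps := Num.min (Num.min delta (x / 2)) (kappa * x / 4).
exists eps; first by rewrite !lt_min de0 !divr_gt0 // mulr_gt0.
move=> z; rewrite !lt_min => /andP[/andP[zd zx] zk] V adj sym deg.
have xm : modulus x%:C = x by rewrite modulus_real gtr0_norm.
have lo : x <= modulus z + modulus (z - x%:C).
  rewrite -[X in X <= _]xm modulusBC.
  by apply: le_trans (modulusD _ _); rewrite addrC subrK.
have hi : modulus z <= x + modulus (z - x%:C).
  rewrite -[X in _ <= X + _]xm.
  by apply: le_trans (modulusD _ _); rewrite addrC subrK.
have zm0 : 0 < modulus z by lra.
have z0 : z != 0 by rewrite -modulus_gt0.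
apply: (domination_neq0 (eta := eta) (delta := delta) (kappa := kappa)) => //.
- exact: ltW.
- have -> : direction z^-1 - 1 = ((modulus z)%:C - z) / z.
    by rewrite /direction modulusV fmorphV invrK mulrBl divff // mulrC.
  rewrite modulusM modulusV ler_pdivrMr //.
  apply: le_trans (_ : modulus ((modulus z)%:C - x%:C) + modulus (x%:C - z) <= _).
    by apply: le_trans (modulusD _ _); rewrite addrA subrK.
  rewrite -rmorphB modulus_real [modulus (_ - z)]modulusBC.
  have : `|modulus z - x| <= modulus (z - x%:C) by rewrite ler_norml; lra.
  nra.
rewrite modulusV invrK.
have bern : 1 - d.+1%:R * (eta / 2) <= (1 - eta / 2) ^+ d.+1.
  apply: bernoulli_le; have : 9 <= D ^+ 2 by nra.
  by move: e0 eD; nra.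
apply: le_trans (_ : (1 - d.+1%:R * (eta / 2)) * modulus z <= _).
  have : d.+1%:R = D - 1 by rewrite /D -(natr1 d.+1) addrK.
  move=> ->; have xE : x = threshold R d + 4 * delta by rewrite /delta; field.
  have eta1 : 0 <= (D - 1) * (eta / 2) <= 1 by nra.
  have zlo : x - delta <= modulus z by lra.
  have f0 : 0 <= 1 - (D - 1) * (eta / 2) by lra.
  apply: le_trans (ler_wpM2l f0 zlo).
  have ex : 0 <= eta * x by rewrite mulr_ge0 // ltW.
  have : 0 <= (D - 1) * (eta / 2) * delta.
    by apply: mulr_ge0 (ltW de0); case/andP: eta1.
  lra.
by rewrite ler_pM2r.
Qed.

End ZeroFreeNeighbourhood.

(** * The open zero-free region *)

Local Open Scope classical_set_scope.
Local Open Scope ring_scope.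
Local Open Scope complex_scope.

Theorem theorem6 (R : realType) (Delta : nat) (hDelta : (2 <= Delta)%N) :
  exists Omega : set R[i]^o,
    [/\ open Omega,
        (forall x : R, threshold R Delta < x -> Omega x%:C)
      & forall (V : finType) (adj : rel V),
          symmetric adj -> irreflexive adj ->
          (max_degree adj <= Delta)%N ->
          forall z : R[i], Omega z -> (domination_poly R[i] adj).[z] != 0].
Proof.
(* The interior of the common zero-free set contains the ray because the radius from
   [zero_free_nbhd] is independent of the graph. *)
pose good : set R[i]^o := [set z : R[i] | forall (V : finType) (adj : rel V),
  symmetric adj -> (max_degree adj <= Delta)%N ->
  (domination_poly R[i] adj).[z] != 0].
exists good°; split; first exact: open_interior.
  move=> x Tx; have [|eps eps0 epsP] := zero_free_nbhd _ Tx; first by lia.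
  apply/nbhs_ballP; exists eps%:C; first by rewrite /= ltcR.
  move=> z; rewrite /ball /= => xz; apply: epsP; rewrite modulusBC.
  by move: xz; rewrite normc_def -modulusE ltcR.
move=> V adj sym _ deg z /interior_subset; exact.
Qed.
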